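(* Let $G$ be a torsion-free discrete Abelian group and let $s,f$ be positive integers. Then for all $x\in\Sigma_s(G)$ and $y\in\Sigma_f(G)$ $$\alpha(s,f)\,\|x\|_2\|y\|_1\le\|x*y\|_2,$$ with lower bound $\alpha(s,f)$ (a constant depending only on $s$ and $f$) satisfying $$\alpha(s,f)>2^{-f^2\log_2\frac{sf}{4}+f\log_2\frac s2-\frac32\log_2(4f)}\;n(s,f)^{-f^2+f-1},$$ where $$n(s,f)=\Big\lfloor 2^{2(s+f-1-\sqrt{s+f-1})\log_2(s+f-1-\sqrt{s+f-1})}\Big\rfloor.$$
   Context: Groups are Abelian and written additively. $G$ is torsion-free if, for every integer $N\ge1$ and $g\in G$, $Ng=0$ holds if and only if $g=0$. ''Discrete'' means that $G$ carries the discrete topology and the counting measure. For a positive integer $k$, $\Sigma_k(G)$ is the set of functions $x\colon G\to\mathbb C$ with $|\operatorname{supp}(x)|\le k$. Convolution is $(x*y)(g)=\sum_{h\in G}x(h)y(g-h)$, and $\|\cdot\|_p$ is the usual $\ell^p(G)$ norm.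
   Formalization: For (s,f)=(1,2) and (2,1), n(s,f)=0 and its negative power is undefined; there the bound is read as 0, so the claim is α(s,f)>0 together with the norm inequality. For s=f=1, 0·log₂0 is read as 0. *)

(* Defs.v *)
From mathcomp Require Import all_boot all_order all_algebra.
From mathcomp Require Import all_classical all_reals all_analysis.
From mathcomp Require Import complex.

Set Implicit Arguments.
Unset Strict Implicit.
Unset Printing Implicit Defensive.

Import Order.TTheory GRing.Theory Num.Theory.

Local Open Scope classical_set_scope.
Local Open Scope card_scope.
Local Open Scope ring_scope.

Definition torsion_free (G : zmodType) : Prop :=
  forall (N : nat) (g : G), (1 <= N)%N -> (g *+ N = 0 <-> g = 0).

Section ShortFunctions.
Context {R : realType} {G : zmodType}.

Definition supp (x : G -> R[i]) : set G := [set g | x g != 0].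

Definition Sigma (k : nat) : set (G -> R[i]) := [set x | supp x #<= `I_k].

(* The sum over G is a finitely supported one (and 0 by convention when
   infinitely many terms are nonzero); all terms outside the support of [x]
   vanish, so it is the usual convolution as soon as [x] is in some
   [Sigma k]. *)
Definition convolution (x y : G -> R[i]) : G -> R[i] :=
  fun g => \sum_(h \in [set: G]) x h * y (g - h).

(* The l^p(G) norm for the counting measure, with value +oo if the sum
   diverges; [Normc.normc] is the R-valued modulus on R[i]. *)
Definition lpnorm (p : R) (x : G -> R[i]) : \bar R :=
  ((\esum_(g in [set: G]) (Normc.normc (x g) `^ p)%:E) `^ p^-1)%E.

End ShortFunctions.

Section Constants.
Context {R : realType}.

Definition log2 (t : R) : R := ln t / ln 2.

(* For s = f = 1 this reads 0 * log2 0, which is 0 since [ln 0 = 0], in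
   agreement with the convention 0 log 0 = 0; hence [nsf 1 1 = 1]. *)
Definition nsf (s f : nat) : int :=
  let m : R := s%:R + f%:R - 1 in
  Num.floor (2 `^ (2 * (m - Num.sqrt m) * log2 (m - Num.sqrt m))).

(* The last factor is an integer power with a negative exponent. When
   {s, f} = {1, 2}, [nsf s f] is 0 and this power has no value on paper; the
   convention [0^-1 = 0] makes the bound equal to 0. *)
Definition alpha_bound (s f : nat) : R :=
  2 `^ (- f%:R ^+ 2 * log2 (s%:R * f%:R / 4) + f%:R * log2 (s%:R / 2)
        - 3 / 2 * log2 (4 * f%:R))
  * (nsf s f)%:~R ^ (- f%:Z ^+ 2 + f%:Z - 1).

End Constants.

(* Main.v *)
Require Import Defs.
From mathcomp Require Import all_boot all_order all_algebra.
From mathcomp Require Import cyclic separable cyclotomic.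
From mathcomp Require Import all_classical all_reals all_analysis.
From mathcomp Require Import complex ring lra zify.

(** On the integers, a sequence with finite support is a Laurent polynomial, and
    |x * y|_2 >= M(x y) = M(x) M(y) by Landau's inequality, M being the Mahler measure. A polynomial
    p with k terms satisfies |p|_1 <= 2^(k-1) M(p), by induction on k (after Akhtari and Vaaler)
    from Mahler's inequality M(p') <= deg(p) M(p) applied to p and to its reciprocal polynomial.
    Hence |x * y|_2 >= 2^-(s+f-2) |x|_2 |y|_1, with no dependence on the diameters of the
    supports; a Freiman isomorphism from the supports into the integers gives the same constant
    in any torsion-free group. For f = 1 the constant is 1, and 2^-(s+f-2) exceeds the
    required bound otherwise. *)

Import Order.TTheory GRing.Theory Num.Theory.

Set Implicit Arguments.
Unset Strict Implicit.
Unset Printing Implicit Defensive.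

Local Open Scope classical_set_scope.
Local Open Scope ring_scope.

(** * Mahler measure *)

(** The Mahler measure is defined from the zeros, without the integral of log |p| over the unit
    circle. Multiplicativity is then immediate, but monotonicity (|p| <= |q| on the circle implies
    M(p) <= M(q)) is not: it comes from comparing n-th powers up to a factor independent of n.
    Mahler's inequality rests on it. Moving the zeros of p into the closed disc gives q with |q| =
    |p| on the circle; Bernstein's argument yields |p'| <= |q'| outside the disc, and by Gauss-Lucas
    q' keeps its zeros in the disc, so that M(q') is the modulus of its leading coefficient, which
    is deg(p) M(p). On the group side, the integer images only have to reproduce which sums a + b
    coincide; a generic linear functional does this for finitely many relations. *)

Section MahlerMeasure.
Variable C : numClosedFieldType.
Implicit Types (p q : {poly C}) (r z w : C) (rs : seq C) (n N : nat).

Local Notation prodXsubC rs := (\prod_(z <- rs) ('X - z%:P)).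

(** The order on [C] is partial; this maximum of 1 and [x] is meant for moduli. *)
Definition max1 (x : C) : C := if 1 <= x then x else 1.

Lemma max1_ge1 x : 1 <= max1 x.
Proof. by rewrite /max1; case: ifP. Qed.

Lemma max1_ge0 x : 0 <= max1 x.
Proof. exact: le_trans ler01 (max1_ge1 x). Qed.

Lemma le_max1 z : `|z| <= max1 `|z|.
Proof.
rewrite /max1; case: ifP => // /negbT; rewrite -real_ltNge ?realE ?ler01//.
  exact: ltW.
by rewrite normr_ge0.
Qed.

Lemma max1_id x : x <= 1 -> max1 x = 1.
Proof. by rewrite /max1; case: ifP => // h1 h2; apply/eqP; rewrite eq_le h1 h2. Qed.

Lemma max1X z N : max1 `|z ^+ N| = max1 `|z| ^+ N.
Proof.
rewrite normrX {2}/max1; case: ifP => [h|/negbT].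
  by rewrite /max1 exprn_ege1.
rewrite -real_ltNge ?realE ?ler01 ?normr_ge0// => /ltW h.
by rewrite expr1n max1_id ?exprn_ile1.
Qed.

(** For nonzero [p] this is, by Jensen's formula, the exponential of the mean of log |p| over the
    unit circle. *)
Definition mahler p : C :=
  `|lead_coef p| * \prod_(z <- sval (closed_field_poly_normal p)) max1 `|z|.

(** Frees the value from the particular list of roots chosen by [closed_field_poly_normal]. *)
Lemma mahlerE c rs :
  mahler (c *: prodXsubC rs) = `|c| * \prod_(z <- rs) max1 `|z|.
Proof.
rewrite /mahler; case: closed_field_poly_normal => s /= es.
have lc : lead_coef (c *: prodXsubC rs) = c.
  by rewrite lead_coefZ lead_coef_prod_XsubC mulr1.
move: es; rewrite lc; have [->|c0 e] := eqVneq c 0; first by rewrite !normr0 !mul0r.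
by rewrite (perm_big _ (prod_XsubC_eq (scalerI c0 e))).
Qed.

Lemma poly_rootsE p : {rs | p = lead_coef p *: prodXsubC rs}.
Proof. exact: closed_field_poly_normal. Qed.

Lemma mahler_ge0 p : 0 <= mahler p.
Proof. by rewrite mulr_ge0 // prodr_ge0 // => z _; rewrite max1_ge0. Qed.

Lemma prod_max1_ge1 rs : 1 <= \prod_(z <- rs) max1 `|z|.
Proof.
elim: rs => [|r rs IH]; first by rewrite big_nil.
by rewrite big_cons mulr_ege1 ?max1_ge1.
Qed.

Lemma lead_le_mahler p : `|lead_coef p| <= mahler p.
Proof. by rewrite /mahler ler_peMr // prod_max1_ge1. Qed.

Lemma mahler0 : mahler 0 = 0.
Proof. by have := mahlerE 0 [::]; rewrite scale0r normr0 mul0r. Qed.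

Lemma mahlerM p q : mahler (p * q) = mahler p * mahler q.
Proof.
case: (poly_rootsE p) (poly_rootsE q) => rs -> [s ->].
rewrite -scalerAl -scalerAr scalerA -big_cat !mahlerE big_cat /= normrM.
by rewrite mulrACA.
Qed.

Lemma mahlerZ c p : mahler (c *: p) = `|c| * mahler p.
Proof.
by case: (poly_rootsE p) => rs ->; rewrite scalerA !mahlerE normrM mulrA.
Qed.

Lemma mahlerC c : mahler c%:P = `|c|.
Proof.
by have := mahlerE c [::]; rewrite !big_nil mulr1 alg_polyC.
Qed.

Lemma mahlerXn n : mahler 'X^n = 1.
Proof.
have := mahlerE 1 (nseq n 0).
by rewrite scale1r !big_nseq !iter_mulr_1 subr0 normr0 normr1 max1_id ?ler01// expr1n mul1r.
Qed.

(** * Coefficient sums: norms and number of terms *)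

Definition sum_coef (V : nmodType) (F : C -> V) p := \sum_(i < size p) F p`_i.

Lemma sum_coefE (V : nmodType) (F : C -> V) p n : F 0 = 0 -> (size p <= n)%N ->
  sum_coef F p = \sum_(i < n) F p`_i.
Proof.
move=> F0 le; rewrite /sum_coef (big_ord_widen n (fun i => F p`_i) le) big_mkcond /=.
by apply: eq_bigr => i _; case: ltnP => // /(nth_default 0) ->; rewrite F0.
Qed.

Lemma sum_coefMXn (V : nmodType) (F : C -> V) p n : F 0 = 0 ->
  sum_coef F (p * 'X^n) = sum_coef F p.
Proof.
move=> F0; have h : (size (p * 'X^n)%R <= n + size p)%N.
  by apply: leq_trans (size_polyMleq _ _) _; rewrite size_polyXn; lia.
rewrite (sum_coefE F0 h) big_split_ord /= big1 ?add0r => [|i _].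
  by apply: eq_bigr => i _; rewrite coefMXn ltnNge leq_addr /= addKn.
by rewrite coefMXn ltn_ord.
Qed.

Definition l1norm : {poly C} -> C := sum_coef Num.norm.
Definition l2sq : {poly C} -> C := sum_coef (fun x : C => `|x| ^+ 2).
Definition nterms : {poly C} -> nat := sum_coef (fun x : C => nat_of_bool (x != 0)).

Lemma l1normE p n : (size p <= n)%N -> l1norm p = \sum_(i < n) `|p`_i|.
Proof. by move=> h; rewrite /l1norm (sum_coefE _ h) ?normr0. Qed.

Lemma l2sqE p n : (size p <= n)%N -> l2sq p = \sum_(i < n) `|p`_i| ^+ 2.
Proof. by move=> h; rewrite /l2sq (sum_coefE _ h) // normr0 expr0n. Qed.

Lemma ntermsE p n : (size p <= n)%N -> nterms p = (\sum_(i < n) (p`_i != 0)%R)%N.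
Proof. by move=> h; rewrite /nterms (sum_coefE _ h) // eqxx. Qed.

(* The difference of the two sides telescopes to 0. *)
Lemma l2sq_reflect r q :
  l2sq (('X - r%:P) * q) = l2sq ((1 - r^* *: 'X) * q).
Proof.
set A := _ * q; set B := _ * q.
pose n := maxn (size q) (maxn (size A) (size B)).
have [sq sA sB] : [/\ (size q <= n)%N, (size A <= n.+1)%N & (size B <= n.+1)%N].
  by rewrite /n; split; lia.
rewrite (l2sqE sA) (l2sqE sB); apply/eqP; rewrite -subr_eq0 -sumrB; apply/eqP.
transitivity ((`|r| ^+ 2 - 1) * `|q`_n| ^+ 2); last first.
  by rewrite (nth_default 0 sq) normr0 expr0n mulr0.
elim: n {sq sA sB} => [|n IH].
  rewrite big_ord1 /A /B mulrBl coefB coefXM coefCM /= mulrBl -scalerAl coefB.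
  by rewrite mul1r coefZ coefXM /= mulr0 subr0 sub0r normrN normrM; ring.
rewrite big_ord_recr /= {}IH /A /B !mulrBl !coefB -scalerAl coefCM mul1r coefZ !coefXM /=.
rewrite !normCK !mul1r !rmorphB !rmorphM /= !conjCK.
set a := q`_n.+1; set b := q`_n; set a' := a^*; set b' := b^*; set r' := r^*.
by ring.
Qed.

(* Each zero r outside the unit disc is traded for the factor 1 - r^* X: this preserves the
   modulus on the unit circle and turns |leading coefficient| into the Mahler measure. *)
Definition reflect1 r := if `|r| <= 1 then 'X - r%:P else 1 - r^* *: 'X.

Definition lead1 r : C := if `|r| <= 1 then 1 else - r^*.
Definition root1 r : C := if `|r| <= 1 then r else (r^*)^-1.

Lemma reflect1E r : reflect1 r = lead1 r *: ('X - (root1 r)%:P).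
Proof.
rewrite /reflect1 /lead1 /root1; case: ifP => [_|/negbT h]; first by rewrite scale1r.
have r0 : r^* != 0 by apply: contra h; rewrite conjC_eq0 => /eqP ->; rewrite normr0 ler01.
by rewrite scalerBr scaleNr -(mul_polyC _ (_%:P)) -polyCM mulNr divff // polyCN opprK polyC1 addrC.
Qed.

Lemma norm_lead1 r : `|lead1 r| = max1 `|r|.
Proof.
rewrite /lead1; case: ifP => [h|/negbT]; first by rewrite normr1 max1_id.
rewrite -real_ltNge ?realE ?ler01 ?normr_ge0// => /ltW h.
by rewrite normrN norm_conjC /max1 h.
Qed.

Lemma norm_root1 r : `|root1 r| <= 1.
Proof.
rewrite /root1; case: ifP => // /negbT.
rewrite -real_ltNge ?realE ?ler01 ?normr_ge0// => /ltW h.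
by rewrite normfV norm_conjC invf_le1 // (lt_le_trans ltr01 h).
Qed.

Definition reflected c rs : {poly C} := c *: \prod_(r <- rs) reflect1 r.

Lemma reflectedE c rs :
  reflected c rs = (c * \prod_(r <- rs) lead1 r) *: prodXsubC (map root1 rs).
Proof.
rewrite /reflected -scalerA big_map; congr (_ *: _).
elim: rs => [|r rs IH]; first by rewrite !big_nil scale1r.
by rewrite !big_cons {}IH reflect1E -scalerAl -scalerAr scalerA.
Qed.

Lemma norm_lead_reflected c rs :
  `|c * \prod_(r <- rs) lead1 r| = mahler (c *: prodXsubC rs).
Proof.
rewrite mahlerE normrM normr_prod; congr (_ * _).
by apply: eq_bigr => r _; rewrite norm_lead1.
Qed.

Lemma norm_reflect1_circle r z : `|z| = 1 -> `|(reflect1 r).[z]| = `|z - r|.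
Proof.
move=> z1; rewrite /reflect1; case: ifP => _; rewrite !hornerE //.
have zz : z * z^* = 1 by rewrite -normCK z1 expr1n.
have -> : 1 - r^* * z = z * (z - r)^* by rewrite rmorphB mulrBr zz mulrC.
by rewrite normrM z1 mul1r norm_conjC.
Qed.

(** For |r| > 1 the quotient (z - r) / (1 - r^* z) is a Blaschke factor, of modulus at most 1
    outside the disc. This domination feeds Bernstein's argument. *)
Lemma norm_reflect1_out r z : 1 <= `|z| -> `|z - r| <= `|(reflect1 r).[z]|.
Proof.
move=> z1; rewrite /reflect1; case: ifP => [_|/negbT]; rewrite ?hornerE //.
rewrite -real_ltNge ?realE ?ler01 ?normr_ge0// => /ltW r1.
rewrite -ler_sqr ?nnegrE ?normr_ge0 // -subr_ge0.
have -> : `|1 - r^* * z| ^+ 2 - `|z - r| ^+ 2 = (`|z| ^+ 2 - 1) * (`|r| ^+ 2 - 1).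
  rewrite !normCK !rmorphB rmorphM rmorph1 /= conjCK.
  by set z' := z^*; set r' := r^*; ring.
by rewrite mulr_ge0 // subr_ge0 exprn_ege1.
Qed.

Lemma horner_prodXsubC rs z : (prodXsubC rs).[z] = \prod_(r <- rs) (z - r).
Proof. by rewrite horner_prod; apply: eq_bigr => r _; rewrite !hornerE. Qed.

Lemma norm_reflected_circle c rs z : `|z| = 1 ->
  `|(reflected c rs).[z]| = `|(c *: prodXsubC rs).[z]|.
Proof.
move=> z1; rewrite !hornerZ horner_prodXsubC horner_prod !normrM !normr_prod.
by congr (_ * _); apply: eq_bigr => r _; rewrite norm_reflect1_circle.
Qed.

Lemma norm_reflected_out c rs z : 1 <= `|z| ->
  `|(c *: prodXsubC rs).[z]| <= `|(reflected c rs).[z]|.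
Proof.
move=> z1; rewrite !hornerZ horner_prodXsubC horner_prod !normrM !normr_prod.
rewrite ler_wpM2l //; apply: ler_prod => r _.
by rewrite normr_ge0 norm_reflect1_out.
Qed.

Lemma l2sq_reflected c rs : l2sq (reflected c rs) = l2sq (c *: prodXsubC rs).
Proof.
suff h q : l2sq (q * \prod_(r <- rs) reflect1 r) = l2sq (q * prodXsubC rs).
  by have := h c%:P; rewrite !mul_polyC.
elim: rs q => [|r rs IH] q; first by rewrite !big_nil.
rewrite !big_cons !mulrA {}IH /reflect1; case: ifP => // _.
by rewrite ![q * _]mulrC -!mulrA -l2sq_reflect.
Qed.

(** The squared leading coefficient of the reflected polynomial is already [mahler p ^+ 2], and it
    is one of the summands of an l2 norm that reflection preserves. *)
Lemma landau p : mahler p ^+ 2 <= l2sq p.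
Proof.
case: (poly_rootsE p) => rs ->; set c := lead_coef p.
rewrite -l2sq_reflected -norm_lead_reflected reflectedE.
set a := c * _; set q := _ *: _.
have -> : a = lead_coef q by rewrite lead_coefZ lead_coef_prod_XsubC mulr1.
have [->|q0] := eqVneq q 0.
  by rewrite lead_coef0 normr0 expr0n sumr_ge0 // => i _; rewrite exprn_ge0.
rewrite /l2sq /sum_coef lead_coefE; have := size_poly_gt0 q; rewrite q0.
case: (size q) => // n _; rewrite big_ord_recr /= lerDr.
by rewrite sumr_ge0 // => i _; rewrite exprn_ge0.
Qed.

(** * Averages and products over roots of unity *)

Lemma prim_root_exists n : (0 < n)%N -> {z : C | n.-primitive_root z}.
Proof.
move=> n_gt0; apply/sigW; case: (poly_rootsE ('X^n - 1)) => rs.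
rewrite (monicP _) ?monicXnsubC // scale1r => Dp.
have rn1 : all n.-unity_root rs by apply/allP => z; rewrite -root_prod_XsubC -Dp.
have sz : (n < (size rs).+1)%N by rewrite -(size_prod_XsubC rs id) -Dp size_XnsubC.
have urs : uniq rs.
  by rewrite -separable_prod_XsubC -Dp separable_Xn_sub_1 // pnatr_eq0 -lt0n.
by case/hasP: (has_prim_root n_gt0 rn1 urs sz) => z _ hz; exists z.
Qed.

Lemma sum_prim_root n z j : n.-primitive_root z ->
  \sum_(i < n) (z ^+ i) ^+ j = (n * (n %| j))%:R.
Proof.
move=> hz; under eq_bigr do rewrite exprAC.
rewrite (prim_order_dvd hz); case: eqVneq => [->|h] /=.
  by under eq_bigr do rewrite expr1n; rewrite sumr_const card_ord muln1.
rewrite muln0; apply: (mulfI (x := z ^+ j - 1)); first by rewrite subr_eq0.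
by rewrite -subrX1 mulr0 exprAC (prim_expr_order hz) expr1n subrr.
Qed.

Lemma norm_prim_root n z : n.-primitive_root z -> `|z| = 1.
Proof.
move=> hz; apply/eqP; rewrite -(pexpr_eq1 (prim_order_gt0 hz)) //.
by rewrite -normrX (prim_expr_order hz) normr1.
Qed.

(** The factor [z ^+ i] raises each exponent by one, so by orthogonality only the top exponent, now
    n + 1, survives. *)
Lemma coef_average n z q : n.+1.-primitive_root z -> (size q <= n.+1)%N ->
  \sum_(i < n.+1) z ^+ i * q.[z ^+ i] = n.+1%:R * q`_n.
Proof.
move=> hz sq; under eq_bigr => i _.
  rewrite (horner_coef_wide _ sq) mulr_sumr.
  under eq_bigr do rewrite mulrCA -exprS.
  over.
rewrite exchange_big /=; under eq_bigr do rewrite -mulr_sumr sum_prim_root //.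
rewrite big_ord_recr /= dvdnn muln1 mulrC big1 ?add0r // => i _.
by rewrite gtnNdvd ?muln0 ?mulr0 // ltnS.
Qed.

(** The leading coefficient of the reflected polynomial has modulus [mahler p] and is, up to
    unimodular weights, an average of its values at roots of unity; there its modulus agrees with
    that of [p]. *)
Lemma mahler_le_sup p : exists2 z, `|z| = 1 & mahler p <= `|p.[z]|.
Proof.
case: (poly_rootsE p) => rs ->; set c := lead_coef p; set n := size rs.
have [w hw] := @prim_root_exists n.+1 isT.
have w1 i : `|w ^+ i| = 1 by rewrite normrX (norm_prim_root hw) expr1n.
set P := _ *: _; case: (boolP [exists i : 'I_n.+1, mahler P <= `|P.[w ^+ i]|]) => [/existsP[i hi]|].
  by exists (w ^+ i).
rewrite negb_exists => /forallP H.
have lt (i : 'I_n.+1) : `|P.[w ^+ i]| < mahler P by have := H i; rewrite -real_ltNge ?realE ?mahler_ge0 ?normr_ge0.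
pose q := reflected c rs.
have sq : (size q <= n.+1)%N.
  rewrite /q reflectedE; apply: leq_trans (size_scale_leq _ _) _.
  by rewrite size_prod_XsubC size_map.
have qn : `|q`_n| = mahler P.
  rewrite -norm_lead_reflected /q reflectedE coefZ.
  have : lead_coef (prodXsubC (map root1 rs)) = 1 by rewrite lead_coef_prod_XsubC.
  by rewrite lead_coefE size_prod_XsubC size_map /= => ->; rewrite mulr1.
have := coef_average hw sq => /(congr1 Num.norm).
rewrite normrM qn normr_nat => e.
suff : `|\sum_(i < n.+1) w ^+ i * q.[w ^+ i]| < n.+1%:R * mahler P by rewrite e ltxx.
apply: le_lt_trans (ler_norm_sum _ _ _) _.
rewrite mulr_natl -[X in _ *+ X]card_ord -sumr_const.
apply: ltr_sum => [|i _]; last by rewrite normrM w1 mul1r norm_reflected_circle.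
by apply/hasP; exists ord0; rewrite ?mem_index_enum.
Qed.

Lemma prod_sub_prim_root n z w r : n.-primitive_root z -> w != 0 ->
  \prod_(i < n) (r - w * z ^+ i) = r ^+ n - w ^+ n.
Proof.
move=> hz w0; have /(congr1 (fun p => p.[r / w])) := factor_Xn_sub_1 hz.
rewrite horner_prod big_mkord !hornerE => e.
have -> : r ^+ n - w ^+ n = w ^+ n * ((r / w) ^+ n - 1).
  by rewrite mulrBr mulr1 exprMn mulrCA -exprMn divff // expr1n mulr1.
rewrite -e -[X in _ ^+ X]card_ord -prodr_const -big_split /=.
by apply: eq_bigr => i _; rewrite !hornerE mulrBr mulrCA divff // mulr1.
Qed.

(** The right-hand side is the modulus, at [w ^+ n], of a Graeffe polynomial with roots [r ^+ n]. *)
Lemma norm_prod_horner_prim_root n z w c rs : n.-primitive_root z -> w != 0 ->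
  \prod_(i < n) `|(c *: prodXsubC rs).[w * z ^+ i]|
    = `|c| ^+ n * \prod_(r <- rs) `|w ^+ n - r ^+ n|.
Proof.
move=> hz w0; transitivity (\prod_(i < n) (`|c| * \prod_(r <- rs) `|w * z ^+ i - r|)).
  by apply: eq_bigr => i _; rewrite hornerZ normrM horner_prodXsubC normr_prod.
rewrite big_split exchange_big /= prodr_const card_ord; congr (_ * _); apply: eq_bigr => r _.
rewrite [RHS]distrC -(prod_sub_prim_root r hz w0) normr_prod.
by apply: eq_bigr => i _; rewrite distrC.
Qed.

(* Graeffe's trick: the n-th powers of the roots are the roots of a polynomial of the same
   degree, so that the loss 2 ^+ size s does not depend on n. *)
Lemma mahlerX_le_circle p d s n : (0 < n)%N ->
  (forall z, `|z| = 1 -> `|p.[z]| <= `|(d *: prodXsubC s).[z]|) ->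
  mahler p ^+ n <= 2 ^+ size s * mahler (d *: prodXsubC s) ^+ n.
Proof.
move=> n0; case: (poly_rootsE p) => rs; move: (lead_coef p) => c -> H.
have [t ht] := prim_root_exists n0.
have t1 i : `|t ^+ i| = 1 by rewrite normrX (norm_prim_root ht) expr1n.
(* A point of the circle where the Graeffe polynomial of [p] is at least its own Mahler measure, the
   product of the [max1 |r| ^+ n]. *)
have [z z1 hz] := mahler_le_sup (1 *: prodXsubC [seq r ^+ n | r <- rs]).
pose w := n.-root z; have wn : w ^+ n = z by rewrite rootCK.
have w1 : `|w| = 1 by apply/eqP; rewrite -(pexpr_eq1 n0) // -normrX wn z1.
have w0 : w != 0 by rewrite -normr_eq0 w1 oner_eq0.
apply: (@le_trans _ _ (\prod_(i < n) `|(c *: prodXsubC rs).[w * t ^+ i]|)).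
  rewrite norm_prod_horner_prim_root // mahlerE exprMn -prodrXl.
  rewrite ler_wpM2l ?exprn_ge0 //; move: hz.
  rewrite mahlerE normr1 mul1r scale1r horner_prodXsubC normr_prod !big_map wn.
  by under eq_bigr do rewrite max1X.
apply: (@le_trans _ _ (\prod_(i < n) `|(d *: prodXsubC s).[w * t ^+ i]|)).
  by apply: ler_prod => i _; rewrite normr_ge0 H // normrM w1 t1 mulr1.
rewrite norm_prod_horner_prim_root // mahlerE exprMn mulrCA -prodrXl.
rewrite ler_wpM2l ?exprn_ge0 // wn.
elim: s {H} => [|r s IH]; first by rewrite !big_nil expr0 mulr1.
rewrite !big_cons /= exprS mulrACA; apply: ler_pM => //; first by rewrite prodr_ge0.
(* Each root costs a factor 2: |z - r^n| <= 1 + |r|^n <= 2 max(1, |r|)^n. *)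
apply: le_trans (ler_normB _ _) _; rewrite z1 -max1X mulr_natl mulr2n.
by rewrite lerD ?max1_ge1 ?le_max1.
Qed.

(** * Monotonicity of the Mahler measure on the unit circle *)

Hypothesis archC : Num.archimedean_axiom C.

(** If a > b > 0, Bernoulli's inequality makes (a / b)^n outgrow any [k]; the archimedean axiom
    enters here. *)
Lemma le_of_expn_le (a b k : C) : 0 <= a -> 0 <= b ->
  (forall n, (0 < n)%N -> a ^+ n <= k * b ^+ n) -> a <= b.
Proof.
move=> a0 b0 H; rewrite real_leNgt ?ger0_real //; apply/negP => ba.
have [b00|bN0] := eqVneq b 0.
  by have := H 1 isT; rewrite b00 expr0n mulr0 expr1 lt_geF // (le_lt_trans b0 ba).
have bp : 0 < b by rewrite lt_def bN0 b0.
pose x := a / b; have x1 : 1 < x by rewrite ltr_pdivlMr // mul1r.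
have xk n : (0 < n)%N -> x ^+ n <= k.
  by move=> n0; rewrite expr_div_n ler_pdivrMr ?exprn_gt0 // H.
have d0 : 0 < x - 1 by rewrite subr_gt0.
have bern n : 1 + n%:R * (x - 1) <= x ^+ n.
  elim: n => [|n IH]; first by rewrite mul0r addr0.
  have -> : x ^+ n.+1 = x ^+ n + (x - 1) * x ^+ n by rewrite exprS; ring.
  rewrite -natr1 mulrDl mul1r addrA.
  rewrite lerD // ler_peMr ?(ltW d0) // exprn_ege1 // ltW //.
have [m hm] := archC (k / (x - 1)).
have kge : 0 <= k by apply: le_trans (xk 1 isT); rewrite expr1 ltW // (lt_trans ltr01).
rewrite ger0_norm ?divr_ge0 // ?ltW // ltr_pdivrMr // in hm.
case: m hm => [|m] hm; first by have := le_lt_trans kge hm; rewrite mul0r ltxx.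
have := le_lt_trans (le_trans (bern m.+1) (xk m.+1 isT)) hm.
by rewrite le_gtF // lerDr ler01.
Qed.

Lemma mahler_le_circle p q :
  (forall z, `|z| = 1 -> `|p.[z]| <= `|q.[z]|) -> mahler p <= mahler q.
Proof.
case: (poly_rootsE q) => s -> H.
by apply: le_of_expn_le => [||n n0]; [exact: mahler_ge0..|exact: mahlerX_le_circle].
Qed.

(** * Bernstein's comparison and Mahler's inequality for derivatives *)

Lemma deriv_prodXsubC rs z : (forall r, r \in rs -> z != r) ->
  (prodXsubC rs)^`().[z] = (prodXsubC rs).[z] * \sum_(r <- rs) (z - r)^-1.
Proof.
elim: rs => [|r rs IH] H; first by rewrite !big_nil derivC horner0 mulr0.
have zr : z - r != 0 by rewrite subr_eq0 H ?mem_head.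
rewrite !big_cons derivM derivXsubC mul1r hornerD !hornerM IH => [|s hs]; last first.
  by rewrite H // in_cons hs orbT.
by rewrite hornerXsubC; field.
Qed.

(* Gauss--Lucas: each z / (z - r) has positive real part when |r| <= 1 < |z|. *)
Lemma deriv_neq0_out p z : (1 < size p)%N -> (forall w, 1 < `|w| -> p.[w] != 0) ->
  1 < `|z| -> p^`().[z] != 0.
Proof.
case: (poly_rootsE p) => rs; move: (lead_coef p) => c -> sp H z1.
have c0 : c != 0 by apply: contraTneq sp => ->; rewrite scale0r size_poly0.
move: sp; rewrite size_scale // size_prod_XsubC ltnS => rs0.
have r1 r : r \in rs -> `|r| <= 1.
  move=> hr; rewrite real_leNgt ?realE ?ler01 ?normr_ge0 //; apply/negP => /H.
  by rewrite -rootE rootZ // root_prod_XsubC hr.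
have zr r : r \in rs -> z != r.
  by move=> hr; apply: contraTneq z1 => ->; rewrite le_gtF ?r1.
rewrite derivZ hornerZ mulf_neq0 // deriv_prodXsubC // mulf_neq0 //.
  by have := H z z1; rewrite hornerZ mulf_eq0 negb_or => /andP[].
set S := \sum_(r <- rs) _; suff : 0 < z * S + (z * S)^*.
  by apply: contraTneq => ->; rewrite mulr0 rmorph0 addr0 ltxx.
rewrite /S mulr_sumr rmorph_sum -big_split /=.
rewrite big_seq; apply: (@le_lt_trans _ _ (\sum_(r <- rs | r \in rs) 0)).
  by rewrite big1_eq.
apply: ltr_sum => [|r hr]; first by case: (rs) rs0 => // r s _; rewrite /= mem_head.
have u0 : z - r != 0 by rewrite subr_eq0 zr.
have u0' : (z - r)^* != 0 by rewrite conjC_eq0.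
have -> : z * (z - r)^-1 + (z * (z - r)^-1)^* =
    (`|z| ^+ 2 - `|r| ^+ 2 + `|z - r| ^+ 2) / `|z - r| ^+ 2.
  rewrite !normCK rmorphM fmorphV /=; move: u0'; rewrite rmorphB /= => u0'.
  by field; rewrite u0 u0'.
rewrite divr_gt0 ?exprn_gt0 ?normr_gt0 // ltr_wpDr ?exprn_ge0 //.
by rewrite subr_gt0 ltr_sqr ?nnegrE // (le_lt_trans (r1 r hr)).
Qed.

(** If it failed, l = P'(z) / Q'(z) would have |l| > 1. Outside the disc |P| <= |Q| < |l Q|, so P -
    l Q has no zero there, and by Gauss-Lucas neither has its derivative, which vanishes at z by the
    choice of l. *)
Lemma norm_deriv_le_reflected c rs z : rs != [::] -> 1 < `|z| ->
  `|(c *: prodXsubC rs)^`().[z]| <= `|(reflected c rs)^`().[z]|.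
Proof.
move=> rs0 z1; have [->|c0] := eqVneq c 0.
  by rewrite scale0r derivC horner0 normr0.
set P := c *: _; set Q := reflected c rs; pose d := c * \prod_(r <- rs) lead1 r.
have eQ : Q = d *: prodXsubC (map root1 rs) by rewrite -reflectedE.
have d1 : `|c| <= `|d|.
  rewrite norm_lead_reflected; apply: le_trans (lead_le_mahler _).
  by rewrite lead_coefZ lead_coef_prod_XsubC mulr1.
have d0 : d != 0 by rewrite -normr_gt0 (lt_le_trans _ d1) ?normr_gt0.
have cP : P`_(size rs) = c.
  rewrite coefZ; have : lead_coef (prodXsubC rs) = 1 by rewrite lead_coef_prod_XsubC.
  by rewrite lead_coefE size_prod_XsubC /= => ->; rewrite mulr1.
have cQ : Q`_(size rs) = d.
  rewrite eQ coefZ; have : lead_coef (prodXsubC (map root1 rs)) = 1.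
    by rewrite lead_coef_prod_XsubC.
  by rewrite lead_coefE size_prod_XsubC size_map /= => ->; rewrite mulr1.
have rs1 : (0 < size rs)%N by case: (rs) rs0.
have Qout w : 1 < `|w| -> Q.[w] != 0.
  move=> w1; rewrite eQ -rootE rootZ // root_prod_XsubC; apply/mapP => -[r _ e].
  by move: w1; rewrite e le_gtF ?norm_root1.
have Q'z : Q^`().[z] != 0.
  by apply: deriv_neq0_out => //; rewrite eQ size_scale // size_prod_XsubC size_map.
rewrite real_leNgt ?realE ?normr_ge0 //; apply/negP => lt.
pose l := P^`().[z] / Q^`().[z].
have l1 : 1 < `|l| by rewrite normf_div ltr_pdivlMr ?normr_gt0 // mul1r.
have : (P - l *: Q)^`().[z] != 0.
  apply: deriv_neq0_out => //.
    (* P - l Q is not constant: its coefficient of index [size rs] is c - l d, nonzero because |c|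
       <= |d| < |l d|. *)
    rewrite ltnNge; apply/negP => sh.
    have : (P - l *: Q)`_(size rs) = 0 by rewrite nth_default // (leq_trans sh).
    rewrite coefB coefZ cP cQ => /eqP; rewrite subr_eq0 => /eqP ce.
    move: d1; rewrite ce normrM lt_geF // ltr_pMl // normr_gt0 //.
  move=> w w1; rewrite hornerD hornerN (hornerZ l) subr_eq0; apply/eqP => e.
  have := norm_reflected_out c rs (ltW w1); rewrite -/P -/Q e normrM.
  by rewrite lt_geF // ltr_pMl // normr_gt0 Qout.
by rewrite derivB (derivZ l) hornerD hornerN (hornerZ l) /l divfK // subrr eqxx.
Qed.

Lemma horner_comp_scale p t z : (p \Po (t *: 'X)).[z] = p.[t * z].
Proof. by rewrite horner_comp !hornerE. Qed.

Lemma comp_scale_prodXsubC c rs t : t != 0 ->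
  (c *: prodXsubC rs) \Po (t *: 'X) =
  (c * t ^+ size rs) *: prodXsubC [seq r / t | r <- rs].
Proof.
move=> t0; rewrite comp_polyZ -scalerA; congr (_ *: _).
elim: rs => [|r rs IH]; first by rewrite !big_nil comp_polyC scale1r.
have e : t *: 'X - r%:P = t *: ('X - (r / t)%:P).
  by rewrite scalerBr -[t *: _%:P]mul_polyC -polyCM mulrC divfK.
rewrite /= !big_cons comp_polyM IH comp_polyB comp_polyX comp_polyC e.
by rewrite -scalerAl -scalerAr scalerA exprS.
Qed.

(** A root r now contributes t max(1, |r| / t) = max(t, |r|). *)
Lemma mahler_comp_scale_ge p t : 1 <= t -> mahler p <= mahler (p \Po (t *: 'X)).
Proof.
move=> t1; have t0 : 0 < t by apply: lt_le_trans ltr01 t1.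
case: (poly_rootsE p) => rs; move: (lead_coef p) => c ->.
rewrite comp_scale_prodXsubC ?gt_eqF // !mahlerE normrM -mulrA ler_wpM2l //.
elim: rs => [|r rs IH]; first by rewrite !big_nil expr0 normr1 mulr1.
rewrite /= !big_cons exprS normrM mulrACA ler_pM ?max1_ge0 ?prodr_ge0 // => [i _|].
  exact: max1_ge0.
rewrite (gtr0_norm t0) {1}/max1; case: ifP => _.
  rewrite -ler_pdivrMl // mulrC; apply: le_trans (le_max1 _).
  by rewrite normf_div (gtr0_norm t0).
by rewrite mulr_ege1 ?max1_ge1.
Qed.

Lemma mahler_deriv p : mahler p^`() <= (size p).-1%:R * mahler p.
Proof.
case: (poly_rootsE p) => rs; move: (lead_coef p) => c ->.
have [->|c0] := eqVneq c 0.
  by rewrite scale0r derivC mahler0 mulr0.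
rewrite size_scale // size_prod_XsubC /=.
have [->|rs0] := eqVneq rs [::].
  by rewrite big_nil alg_polyC derivC mahler0 mul0r.
set P := c *: _; set Q := reflected c rs; pose d := c * \prod_(r <- rs) lead1 r.
have eQ : Q = d *: prodXsubC (map root1 rs) by rewrite -reflectedE.
pose n := (size rs).-1; have en : size rs = n.+1 by rewrite /n; case: (rs) rs0.
have dM : `|d| = mahler P by rewrite norm_lead_reflected.
clearbody d.
(* The derivatives compare only strictly outside the disc, so the circle is first dilated by t > 1,
   at the price of [t ^+ n]. *)
have H t : 1 < t -> mahler P^`() <= t ^+ n * ((size rs)%:R * mahler P).
  move=> t1; have t0 : 0 < t by apply: lt_trans ltr01 t1.
  apply: le_trans (mahler_comp_scale_ge _ (ltW t1)) _.
  apply: (@le_trans _ _ (mahler (Q^`() \Po (t *: 'X)))).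
    apply: mahler_le_circle => z z1; rewrite !horner_comp_scale.
    by rewrite norm_deriv_le_reflected // normrM z1 mulr1 gtr0_norm.
  have [d00|d0] := eqVneq d 0.
    by rewrite eQ d00 scale0r derivC comp_polyC mahler0 -dM d00 normr0 !mulr0.
  have sQ : size Q = n.+2 by rewrite eQ size_scale // size_prod_XsubC size_map en.
  have lQ : lead_coef Q = d by rewrite eQ lead_coefZ lead_coef_prod_XsubC mulr1.
  have sQ' : size Q^`() = n.+1.
    apply/eqP; rewrite eqn_leq -ltnS -{1}sQ lt_size_deriv -?size_poly_eq0 ?sQ //=.
    rewrite ltnNge; apply/negP => /leq_sizeP/(_ n (leqnn n)); rewrite coef_deriv.
    by move/eqP; rewrite mulrn_eq0 /=; move: lQ; rewrite lead_coefE sQ /= => ->; apply/negP.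
  have lQ' : lead_coef Q^`() = d * n.+1%:R.
    by rewrite lead_coefE sQ' coef_deriv -lQ lead_coefE sQ mulr_natr.
  have roots1 r : root Q^`() r -> `|r| <= 1.
    move=> hr; rewrite real_leNgt ?realE ?ler01 ?normr_ge0 //; apply/negP => r1.
    have := @deriv_neq0_out Q r; rewrite sQ (rootP hr) eqxx => /(_ isT) H; apply: notF; apply: H => // w w1.
    rewrite eQ -rootE rootZ // root_prod_XsubC; apply/mapP => -[s _ e].
    by move: w1; rewrite e le_gtF ?norm_root1.
  case: (poly_rootsE Q^`()) => s es; have l0 : lead_coef Q^`() != 0.
    by rewrite lead_coef_eq0 -size_poly_eq0 sQ'.
  have ss : size s = n by move: sQ'; rewrite {1}es size_scale // size_prod_XsubC => -[].
  (* The zeros r / t of the dilated derivative remain in the disc, so only its leading coefficient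
     counts. *)
  rewrite es comp_scale_prodXsubC ?gt_eqF // mahlerE big_map big_seq big1 => [|r hr].
    by rewrite mulr1 lQ' ss en !normrM normr_nat dM (gtr0_norm (exprn_gt0 _ t0)) mulrC (mulrC (mahler P)).
  rewrite max1_id // normf_div (gtr0_norm t0) ler_pdivrMr // mul1r.
  apply: le_trans (ltW t1); apply: roots1.
  by rewrite es rootZ // root_prod_XsubC.
set b := _ * mahler P in H *; set a := mahler _ in H *.
have a0 : 0 <= a by exact: mahler_ge0.
have b0 : 0 <= b by rewrite mulr_ge0 ?mahler_ge0 ?ler0n.
rewrite real_leNgt ?ger0_real //; apply/negP => ba.
have bn0 : b != 0.
  apply: contraTneq ba => b00; have := H 2; rewrite b00 mulr0 => /(_ _) h.
  by rewrite le_gtF // h // ltr1n.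
have bp : 0 < b by rewrite lt_def bn0 b0.
have x1 : 1 < a / b by rewrite ltr_pdivlMr // mul1r.
(* This choice replaces the limit t -> 1: t^n < t^(n+1) = a / b contradicts [H]. *)
pose t := n.+1.-root (a / b); have t1 : 1 < t by rewrite rootC_gt1.
have := H t t1; rewrite lt_geF // -ltr_pdivlMr // -(rootCK (n := n.+1) _ (a / b)) // -/t.
by rewrite ltr_eXn2l.
Qed.

(** * Reciprocal polynomials and the l1 norm *)

Definition revp n p : {poly C} := \poly_(i < n.+1) p`_(n - i).

Lemma revpMXsubC n r q : (size q <= n.+1)%N ->
  revp n.+1 (('X - r%:P) * q) = (1 - r *: 'X) * revp n q.
Proof.
move=> sq; apply/polyP => i; rewrite coef_poly [(1 - _) * _]mulrBl mul1r -scalerAl coefB coefZ coefXM.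
rewrite !coef_poly; case: i => [|i] /=.
  by rewrite mulrBl coefB coefXM coefCM /= !subn0 (nth_default 0 sq) !mulr0.
rewrite !ltnS subSS; have [lt|] := ltnP i n.
  by rewrite (ltnW lt) mulrBl coefB coefXM coefCM subn_eq0 leqNgt lt /= subnS.
rewrite leq_eqVlt => /orP[/eqP <-|lt]; last by rewrite leqNgt lt mulr0 subr0.
by rewrite leqnn subnn mulrBl coefB coefXM coefCM.
Qed.

Lemma mahler_XsubC r : mahler ('X - r%:P) = max1 `|r|.
Proof. by have := mahlerE 1 [:: r]; rewrite !big_seq1 scale1r normr1 mul1r. Qed.

Lemma mahler_1subZX r : mahler (1 - r *: 'X) = max1 `|r|.
Proof.
have [->|r0] := eqVneq r 0.
  by rewrite scale0r subr0 -polyC1 mahlerC normr1 normr0 max1_id ?ler01.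
have -> : 1 - r *: 'X = (- r) *: ('X - r^-1%:P).
  by rewrite scalerBr scaleNr -(mul_polyC _ (_%:P)) -polyCM mulNr divff // polyCN opprK polyC1 addrC.
rewrite mahlerZ mahler_XsubC normrN normfV.
have rp : 0 < `|r| by rewrite normr_gt0.
rewrite /max1 invf_ge1 //; have [r1|r1|r1] := real_ltgtP (ger0_real (normr_ge0 r)) (real1 _).
- by rewrite divff // normr_eq0.
- by rewrite mulr1.
- by rewrite r1 invr1 mulr1.
Qed.

(** Reversal turns each factor X - r into 1 - r X, which has the same Mahler measure since |r|
    max(1, 1 / |r|) = max(1, |r|) for r nonzero. *)
Lemma mahler_revp p : mahler (revp (size p).-1 p) = mahler p.
Proof.
case: (poly_rootsE p) => rs; move: (lead_coef p) => c ->.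
have [->|c0] := eqVneq c 0.
  rewrite scale0r size_poly0 mahler0 /revp poly_def big1 ?mahler0 // => i _.
  by rewrite coef0 scale0r.
rewrite size_scale // size_prod_XsubC /= mahlerE.
elim: rs => [|r rs IH].
  rewrite !big_nil alg_polyC mulr1 -[RHS]mahlerC; congr mahler; apply/polyP => i.
  by rewrite coef_poly !coefC ltnS leqn0; case: eqP.
rewrite !big_cons scalerAr revpMXsubC ?mahlerM ?IH ?mahler_1subZX; first by rewrite mulrCA.
by rewrite size_scale // size_prod_XsubC.
Qed.

Lemma sum_coef_revp (V : nmodType) (F : C -> V) n p : F 0 = 0 -> (size p <= n.+1)%N ->
  sum_coef F (revp n p) = sum_coef F p.
Proof.
move=> F0 sp; rewrite (sum_coefE F0 sp) (sum_coefE F0 (size_poly _ _)).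
rewrite (reindex_inj rev_ord_inj) /=; apply: eq_bigr => i _.
by rewrite coef_poly subSS ltnS leq_subr subKn // -ltnS.
Qed.

Lemma l1norm_deriv p n : (size p <= n.+1)%N ->
  l1norm p^`() = \sum_(i < n.+1) i%:R * `|p`_i|.
Proof.
move=> sp; rewrite (@l1normE _ n).
  rewrite big_ord_recl mul0r add0r; apply: eq_bigr => i _.
  by rewrite coef_deriv normrMn mulr_natl.
apply/leq_sizeP => i hi; rewrite coef_deriv nth_default ?mul0rn //.
exact: leq_trans sp _.
Qed.

(** In characteristic 0 differentiation kills the constant term and no other. *)
Lemma nterms_deriv p : p`_0 != 0 -> nterms p = (nterms p^`()).+1.
Proof.
move=> p0; rewrite (@ntermsE p (size p).+1) // big_ord_recl p0.
congr (_.+1); rewrite (@ntermsE _ (size p)); last first.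
  by apply: leq_trans (leq_pred _); exact: size_poly.
by apply: eq_bigr => i _; rewrite coef_deriv mulrn_eq0.
Qed.

Lemma split_Xn p : p != 0 -> exists n, exists2 q : {poly C}, q`_0 != 0 & p = q * 'X^n.
Proof.
move=> p0; case: (multiplicity_XsubC p 0) => n [q]; rewrite p0 /= rootE horner_coef0 subr0.
by exists n, q.
Qed.

Lemma l1norm_ge0 p : 0 <= l1norm p.
Proof. by rewrite sumr_ge0. Qed.

(** The coefficient of index i has weight i in the first derivative and n - i in the second. *)
Lemma l1norm_deriv_revp p n : (size p <= n.+1)%N ->
  n%:R * l1norm p = l1norm p^`() + l1norm (revp n p)^`().
Proof.
move=> sp; rewrite (l1normE sp) (l1norm_deriv sp) (l1norm_deriv (size_poly _ _)).
rewrite [X in _ + X](reindex_inj rev_ord_inj) -big_split /= mulr_sumr.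
apply: eq_bigr => i _; rewrite coef_poly subSS ltnS leq_subr subKn; last by rewrite -ltnS.
by rewrite -mulrDl -natrD subnKC // -ltnS.
Qed.

(* If p has degree n and nonzero constant term, then n |p|_1 = |p'|_1 + |(rev p)'|_1, and both
   derivatives have fewer terms than p. *)
Lemma l1norm_le_mahler p k : (nterms p <= k.+1)%N -> l1norm p <= 2 ^+ k * mahler p.
Proof.
elim/ltn_ind: k p => k IH p hp.
have [->|p0] := eqVneq p 0.
  by rewrite /l1norm /sum_coef size_poly0 big_ord0 mulr_ge0 ?mahler_ge0 ?exprn_ge0 ?ler0n.
case: (split_Xn p0) hp => m [q q0 ->]; rewrite mahlerM mahlerXn mulr1.
rewrite /nterms /l1norm !sum_coefMXn ?normr0 ?eqxx // -/(nterms q) -/(l1norm q) => hq.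
have qn0 : q != 0 by apply: contraNneq q0 => ->; rewrite coef0.
case sq : (size q) => [|[|n]]; first by move/eqP: sq; rewrite size_poly_eq0 (negPf qn0).
  have [c c0 ->] := size_poly1P _ (introT eqP sq).
  rewrite mahlerC /l1norm /sum_coef size_polyC c0 big_ord1 coefC eqxx.
  by rewrite ler_peMl ?exprn_ege1 // ler1n.
have lq : q`_n.+1 != 0 by have := qn0; rewrite -lead_coef_eq0 lead_coefE sq.
have sq2 : (size q <= n.+2)%N by rewrite sq.
(* For [k = 0] there is a contradiction: the first and last coefficients of [q] are two distinct
   terms. *)
case: k IH hq => [|k] IH hq.
  by move: hq; rewrite (ntermsE sq2) big_ord_recl big_ord_recr /= q0 lq; lia.
pose r := revp n.+1 q.
have nr : nterms r = nterms q by rewrite /nterms sum_coef_revp ?eqxx.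
have r0 : r`_0 != 0 by rewrite coef_poly subn0.
have sr : size r = n.+2.
  by apply: size_poly_eq; rewrite subnn.
have Mr : mahler r = mahler q by rewrite -[RHS]mahler_revp sq.
have n0 : (0 : C) < n.+1%:R by rewrite ltr0n.
rewrite -(ler_pM2l n0) (l1norm_deriv_revp sq2).
have step (t : {poly C}) : size t = n.+2 -> t`_0 != 0 -> nterms t = nterms q -> mahler t = mahler q ->
    l1norm t^`() <= n.+1%:R * (2 ^+ k * mahler q).
  move=> st t0 nt Mt; apply: le_trans (IH k _ _ _) _ => //.
    by rewrite -ltnS -nterms_deriv // nt.
  rewrite [leRHS]mulrCA ler_wpM2l ?exprn_ge0 ?ler0n //.
  by apply: le_trans (mahler_deriv _) _; rewrite st Mt.
(* One half is for [q], the other for its reciprocal: this is the doubling at each step. *)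
have -> : n.+1%:R * (2 ^+ k.+1 * mahler q) =
    n.+1%:R * (2 ^+ k * mahler q) + n.+1%:R * (2 ^+ k * mahler q) by rewrite exprS; ring.
by rewrite lerD ?step.
Qed.

Lemma l2sq_le_l1norm p : l2sq p <= l1norm p ^+ 2.
Proof.
rewrite /l2sq /l1norm /sum_coef; elim: (size p) => [|n IH].
  by rewrite !big_ord0 expr0n.
rewrite !big_ord_recr /= sqrrD; apply: lerD => //; apply: le_trans IH _.
by rewrite lerDl mulrn_wge0 // mulr_ge0 // sumr_ge0.
Qed.

(** The l2 norm of [p] is first enlarged to its l1 norm, so that both factors are controlled by
    Mahler measures. Squares keep square roots out of [C]. *)
Theorem l2sq_mul_ge p q s f : (nterms p <= s.+1)%N -> (nterms q <= f.+1)%N ->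
  l2sq p * l1norm q ^+ 2 <= (2 ^+ (s + f)) ^+ 2 * l2sq (p * q).
Proof.
move=> hp hq; apply: (@le_trans _ _ ((l1norm p * l1norm q) ^+ 2)).
  by rewrite exprMn ler_wpM2r ?exprn_ge0 ?l1norm_ge0 // l2sq_le_l1norm.
apply: (@le_trans _ _ ((2 ^+ (s + f)) ^+ 2 * mahler (p * q) ^+ 2)); last first.
  by rewrite ler_wpM2l ?landau // exprn_ge0 // exprn_ge0 // ler0n.
have l0 : 0 <= l1norm p * l1norm q by rewrite mulr_ge0 ?l1norm_ge0.
have m0 : 0 <= 2 ^+ (s + f) * mahler (p * q).
  by apply: mulr_ge0; [rewrite exprn_ge0 | exact: mahler_ge0].
rewrite -exprMn ler_sqr ?nnegrE //.
by rewrite exprD mahlerM mulrACA ler_pM ?l1norm_ge0 ?l1norm_le_mahler.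
Qed.

(** Multiplication by c X^m only shifts and scales; this gives the constant 1 for f = 1. *)
Lemma l2sq_mul_monomial p q : (nterms q <= 1)%N ->
  l2sq p * l1norm q ^+ 2 = l2sq (p * q).
Proof.
have [-> _|q0] := eqVneq q 0.
  by rewrite mulr0 /l2sq /l1norm /sum_coef size_poly0 !big_ord0 expr0n mulr0.
case: (split_Xn q0) => m [r r0 ->].
rewrite mulrA /nterms /l1norm /l2sq !sum_coefMXn ?normr0 ?eqxx ?expr0n // => hr.
have rn0 : r != 0 by apply: contraNneq r0 => ->; rewrite coef0.
have sr : size r == 1%N.
  case sr : (size r) => [|[|n]] //; first by move/eqP: sr; rewrite size_poly_eq0 (negPf rn0).
  have lr : r`_n.+1 != 0 by have := rn0; rewrite -lead_coef_eq0 lead_coefE sr.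
  by move: hr; rewrite -/(nterms r) (@ntermsE _ n.+2) ?sr // big_ord_recl big_ord_recr /= r0 lr; lia.
have [c c0 ->] := size_poly1P _ sr.
rewrite [p * _]mulrC mul_polyC -/(l2sq (c *: p)) (@l2sqE _ (size p)) ?size_scale //.
rewrite /sum_coef size_polyC c0 big_ord1 coefC eqxx mulr_suml.
by apply: eq_bigr => i _; rewrite coefZ normrM exprMn mulrC.
Qed.

End MahlerMeasure.

(** * Freiman isomorphisms into the integers *)

Lemma common_denominator (s : seq rat) :
  exists2 n : nat, (0 < n)%N & {in s, forall x, n%:R * x \is a Num.int}.
Proof.
elim: s => [|x s [n n0 IH]]; first by exists 1%N.
have dx : `|denq x|%:R * x = (numq x)%:~R :> rat.
  by rewrite pmulrn absz_denq numqE mulrC.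
exists (n * `|denq x|)%N; first by rewrite muln_gt0 n0 absz_gt0 denq_neq0.
move=> y; rewrite in_cons natrM => /orP[/eqP ->|/IH hy].
  by rewrite -mulrA dx rpredM ?rpred_nat ?intr_int.
by rewrite mulrAC rpredM ?rpred_nat.
Qed.

Lemma exists_nonroot (p : {poly rat}) : p != 0 -> exists t, ~~ root p t.
Proof.
move=> p0; pose s := [seq i%:R : rat | i <- iota 0 (size p)].
have us : uniq s by rewrite map_inj_uniq ?iota_uniq // => i j /eqP; rewrite eqr_nat => /eqP.
have [hs|] := boolP (all (root p) s).
  by have := max_poly_roots p0 hs us; rewrite size_map size_iota ltnn.
by case/allPn => t _ ht; exists t.
Qed.

Section TorsionFree.
Variable G : zmodType.
Hypothesis tfG : torsion_free G.

Section Evaluation.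
Variables (k : nat) (g : 'I_k -> G).

Definition evalz (c : 'rV[int]_k) : G := \sum_i g i *~ c 0 i.

Lemma evalzD c d : evalz (c + d) = evalz c + evalz d.
Proof. by rewrite -big_split; apply: eq_bigr => i _; rewrite mxE mulrzDr. Qed.

Lemma evalzN c : evalz (- c) = - evalz c.
Proof. by rewrite -sumrN; apply: eq_bigr => i _; rewrite mxE mulrNz. Qed.

Lemma evalz_delta i : evalz (delta_mx 0 i) = g i.
Proof.
rewrite /evalz (bigD1 i) //= mxE !eqxx big1 ?addr0 // => j /negPf ji.
by rewrite mxE ji andbF.
Qed.

(* A relation which is a rational combination of relations of G is one too, since G is
   torsion-free. *)
Lemma evalz_eq0_span m (M : 'I_m -> 'rV[int]_k) d :
  (forall i, evalz (M i) = 0) ->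
  (map_mx intr d <= (\matrix_i map_mx intr (M i) : 'M[rat]_(m, k)))%MS -> evalz d = 0.
Proof.
move=> M0 /submxP[u ud]; have [n n0 hn] := common_denominator [seq u 0 i | i : 'I_m].
pose w i := Num.floor (n%:R * u 0 i).
have wE i : (w i)%:~R = n%:R * u 0 i by apply: floorK; apply: hn; apply: map_f; rewrite mem_enum.
have e j : n%:R * d 0 j = \sum_i w i * M i 0 j.
  apply: (@intr_inj rat); rewrite rmorphM rmorph_sum /= rmorph_nat.
  have /matrixP/(_ 0 j) := ud; rewrite !mxE => ->; rewrite mulr_sumr.
  by apply: eq_bigr => i _; rewrite rmorphM /= wE !mxE mulrA.
apply/(tfG (evalz d) n0); rewrite pmulrn /evalz mulrz_suml.
transitivity (\sum_i (evalz (M i)) *~ w i); last by rewrite big1 // => i _; rewrite M0 mul0rz.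
under [RHS]eq_bigr do rewrite /evalz mulrz_suml.
rewrite exchange_big /=; apply: eq_bigr => j _; rewrite -mulrzA mulrC -[n%:Z]natz e.
by rewrite mulrz_sumr; apply: eq_bigr => i _; rewrite -mulrzA mulrC.
Qed.

(** Modulo the rational span of the relations in [F], relations vanish and the other members of [F]
    do not. Pairing with (1, t, t^2, ...) turns the latter into finitely many nonzero polynomials in
    t, and a common non-root t separates; denominators are cleared last. *)
Lemma separating_functional (F : seq 'rV[int]_k) :
  exists v : 'I_k -> int,
    {in F, forall c : 'rV[int]_k, (\sum_i c 0 i * v i == 0) = (evalz c == 0)}.
Proof.
pose Z := [seq c <- F | evalz c == 0].
pose M : 'M[rat]_(size Z, k) := \matrix_i map_mx intr (nth 0 Z i).
pose K := cokermx M.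
pose r c := map_mx intr c *m K : 'rV[rat]_k.
have r0 c : c \in F -> evalz c == 0 -> r c = 0.
  move=> cF c0; have cZ : c \in Z by rewrite mem_filter c0.
  have lt : (index c Z < size Z)%N by rewrite index_mem.
  have := congr1 (row (Ordinal lt)) (mulmx_coker M); rewrite row_mul rowK /= nth_index //.
  by rewrite row0.
have rN0 c : c \in F -> evalz c != 0 -> r c != 0.
  move=> cF; apply: contra => /eqP rc; apply/eqP.
  apply: (@evalz_eq0_span _ (fun i : 'I_(size Z) => nth 0 Z i)).
    by move=> i; have := mem_nth 0 (ltn_ord i); rewrite mem_filter => /andP[/eqP].
  by rewrite submxE; apply/eqP.
pose P c : {poly rat} := \poly_(i < k) (if insub i is Some j then r c 0 j else 0).
have PE c t : (P c).[t] = \sum_i r c 0 i * t ^+ i.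
  rewrite horner_poly; apply: eq_bigr => i _; case: insubP => [j _ ji|]; last by rewrite ltn_ord. 
  by congr (r c 0 _ * _); apply: val_inj.
have PN0 c : c \in F -> evalz c != 0 -> P c != 0.
  move=> cF c0; apply: contra (rN0 c cF c0) => /eqP Pc; apply/eqP/rowP => j.
  have := congr1 (fun p : {poly rat} => p`_j) Pc; rewrite coef_poly ltn_ord coef0.
  case: insubP => [i _ ij|]; last by rewrite ltn_ord.
  have -> : i = j by apply: val_inj.
  by move=> ->; rewrite mxE.
have Q0 : \prod_(c <- F | evalz c != 0) P c != 0.
  by rewrite prodf_seq_neq0; apply/allP => c cF; apply/implyP; exact: PN0.
have [t ht] := exists_nonroot Q0.
(* The functional pulled back through the cokernel map, so that its value at [c] is [(P c).[t]]. *)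
pose v i := \sum_j K i j * t ^+ j.
have vE (c : 'rV[int]_k) : \sum_i (c 0 i)%:~R * v i = (P c).[t].
  rewrite PE; under eq_bigr do rewrite mulr_sumr.
  rewrite exchange_big; apply: eq_bigr => j _; rewrite mxE mulr_suml.
  by apply: eq_bigr => i _; rewrite mulrA; congr (_ * _ * _); rewrite [RHS]mxE.
have [n n0 hn] := common_denominator [seq v i | i : 'I_k].
pose w i := Num.floor (n%:R * v i).
have wE i : (w i)%:~R = n%:R * v i by apply: floorK; apply: hn; apply: map_f; rewrite mem_enum.
exists w => c cF.
have -> : (\sum_i c 0 i * w i == 0) = ((P c).[t] == 0).
  rewrite -vE -(intr_eq0 rat) rmorph_sum /=.
  rewrite (eq_bigr (fun i => n%:R * ((c 0 i)%:~R * v i))).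
    by rewrite -mulr_sumr mulf_eq0 pnatr_eq0 gtn_eqF.
  by move=> i _; rewrite rmorphM /= wE mulrCA.
case: (boolP (evalz c == 0)) => [c0|c0].
  by rewrite PE r0 // big1 ?eqxx // => i _; rewrite mxE mul0r.
apply/negbTE; apply: contra ht => /eqP h; rewrite rootE horner_prod.
by rewrite prodf_seq_eq0; apply/hasP; exists c => //; rewrite c0 h eqxx.
Qed.

End Evaluation.

(* The translation by a constant, which makes the values natural numbers, is harmless as the
   relations are balanced. *)
Lemma freiman_embedding (T : seq G) : exists phi : G -> nat,
  forall a b c d, a \in T -> b \in T -> c \in T -> d \in T ->
    (phi a + phi b == phi c + phi d)%N = (a + b == c + d).
Proof.
case: T => [|x0 T0]; first by exists (fun=> 0%N) => a b c d.
set T := x0 :: T0; pose k := (size T).-1.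
pose g (i : 'I_k.+1) := nth 0 T i.
pose ix a : 'I_k.+1 := inord (index a T).
have gix a : a \in T -> g (ix a) = a.
  move=> aT; have lt : (index a T < size T)%N by rewrite index_mem.
  by rewrite /g inordK // nth_index.
(* The formal vector that evaluates to a + b - (c + d). *)
pose rel a b c d : 'rV[int]_k.+1 :=
  delta_mx 0 (ix a) + delta_mx 0 (ix b) - (delta_mx 0 (ix c) + delta_mx 0 (ix d)).
have [v hv] := @separating_functional _ g
  [seq rel p.1.1 p.1.2 p.2.1 p.2.2 | p <- allpairs pair (allpairs pair T T) (allpairs pair T T)].
pose N := \sum_i `|v i|.
have vN i : 0 <= v i + N.
  have : `|v i| <= N by rewrite /N (bigD1 i) //= lerDl sumr_ge0.
  by rewrite -[`|v i|]opprK lerNl => h; have := ler_norm (- v i); rewrite normrN; lia.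
exists (fun a => absz (v (ix a) + N)) => a b c d aT bT cT dT.
have := hv (rel a b c d); rewrite (_ : rel a b c d \in _ = true); last first.
  apply/mapP; exists ((a, b), (c, d)) => //; apply: allpairs_f; exact: allpairs_f.
move=> /(_ isT); rewrite evalzD evalzN !evalzD !evalz_delta !gix // [RHS]subr_eq0 => <-.
have sum_delta i : \sum_j (delta_mx 0 i : 'rV[int]_k.+1) 0 j * v j = v i.
  rewrite (bigD1 i) //= mxE !eqxx mul1r big1 ?addr0 // => j /negPf ji.
  by rewrite mxE ji andbF mul0r.
have -> : \sum_i rel a b c d 0 i * v i = v (ix a) + v (ix b) - (v (ix c) + v (ix d)).
  rewrite -!sum_delta -!big_split -sumrB /=; apply: eq_bigr => i _.
  by rewrite ![rel _ _ _ _ _ _]mxE; rewrite !mxE; ring.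
have := vN (ix a); have := vN (ix b); have := vN (ix c); have := vN (ix d).
by move=> *; apply/eqP/eqP; lia.
Qed.

End TorsionFree.

(** * The constant *)

Section AlphaBound.
Variable R : realType.
Implicit Types (s f : nat) (t u : R).

Lemma ln2_gt0 : 0 < ln 2 :> R.
Proof. by rewrite ln_gt0 // ltr1n. Qed.

Lemma log2M t u : 0 < t -> 0 < u -> log2 (t * u) = log2 t + log2 u :> R.
Proof. by move=> t0 u0; rewrite /log2 lnM ?posrE // mulrDl. Qed.

Lemma log2V t : 0 < t -> log2 t^-1 = - log2 t :> R.
Proof. by move=> t0; rewrite /log2 lnV ?posrE // mulNr. Qed.

Lemma log2_2 : log2 2 = 1 :> R.
Proof. by rewrite /log2 divff // gt_eqF // ln2_gt0. Qed.

Lemma log2X t k : 0 < t -> log2 (t ^+ k) = k%:R * log2 t :> R.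
Proof. by move=> t0; rewrite /log2 lnXn // mulr_natl mulrnAl. Qed.

Lemma le_log2 t u : 0 < t -> t <= u -> log2 t <= log2 u :> R.
Proof.
move=> t0 tu; rewrite /log2 ler_pM2r ?invr_gt0 ?ln2_gt0 //.
by rewrite ler_ln ?posrE // (lt_le_trans t0).
Qed.

Lemma log2_1 : log2 1 = 0 :> R.
Proof. by rewrite /log2 ln1 mul0r. Qed.

Lemma ltr_powR2 t u : t < u -> 2 `^ t < 2 `^ u :> R.
Proof.
move=> tu; rewrite /powR pnatr_eq0 /=.
by rewrite ltr_expR ltr_pM2r // ln2_gt0.
Qed.

Definition bound_exponent s f : R :=
  - f%:R ^+ 2 * log2 (s%:R * f%:R / 4) + f%:R * log2 (s%:R / 2) - 3 / 2 * log2 (4 * f%:R).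

(** In this form the signs are visible: for f >= 2 and s f >= 4 no summand is positive. *)
Lemma bound_exponentE s f : (0 < s)%N -> (0 < f)%N ->
  bound_exponent s f = - (f%:R ^+ 2 - f%:R) * (log2 s%:R + log2 f%:R - 2)
    + f%:R * (1 - log2 f%:R) - 3 / 2 * (log2 f%:R + 2).
Proof.
move=> s0 f0; have s0' : (0 : R) < s%:R by rewrite ltr0n.
have f0' : (0 : R) < f%:R by rewrite ltr0n.
have l4 : log2 4 = 2 :> R by rewrite (_ : 4 = 2 ^+ 2) ?log2X ?log2_2 ?mulr1 // -natrX.
rewrite /bound_exponent !log2M ?log2V ?l4 ?log2_2 ?invr_gt0 ?mulr_gt0 //.
by ring.
Qed.

Lemma nsf_ge0 s f : 0 <= @nsf R s f.
Proof. by rewrite floor_ge0 powR_ge0. Qed.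

Lemma nsf_exponent f : - f%:Z ^+ 2 + f%:Z - 1 = - (f ^ 2 - f + 1)%N%:Z.
Proof.
have h : (f <= f ^ 2)%N by case: f => // f; rewrite expnS expn1 leq_pmulr.
by rewrite PoszD -subzn // -[in RHS]natz natrX natz; ring.
Qed.

Lemma nsf_pow_le1 s f : ((@nsf R s f)%:~R : R) ^ (- f%:Z ^+ 2 + f%:Z - 1) <= 1.
Proof.
rewrite nsf_exponent addn1; case: (nsf s f) (nsf_ge0 s f) => // -[|n] _.
  (* When [nsf] is 0 the power is 0 by the convention on inverses. *)
  by rewrite -exprnN expr0n invr0 ler01.
by rewrite -exprnN invf_le1 ?exprn_gt0 ?ltr0n // exprn_ege1 // ler1n.
Qed.

(** For m = s + f - 1 >= 4, u = m - sqrt m is at least m / 2 >= 2, so log2 u >= 1 and the exponent 2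
    u log2 u is at least m. *)
Lemma nsf_ge s f : (0 < s)%N -> (0 < f)%N -> (5 <= s + f)%N ->
  (2 ^ (s + f - 1))%N%:Z <= @nsf R s f.
Proof.
move=> s0 f0 h; rewrite /nsf floor_ge_int.
have -> : s%:R + f%:R - 1 = (s + f - 1)%N%:R :> R by rewrite natrB ?natrD // addn_gt0 s0.
set k := (s + f - 1)%N; set m : R := k%:R.
have m4 : 4 <= m by rewrite ler_nat /k; lia.
have sm : Num.sqrt m <= m / 2.
  have m0 : 0 <= m by lra.
  rewrite -(@ler_pXn2r _ 2) ?nnegrE ?sqrtr_ge0 ?divr_ge0 // sqr_sqrtr //.
  by rewrite -subr_ge0; have -> : (m / 2) ^+ 2 - m = m * (m - 4) / 4 by [field]; nra.
set u := m - Num.sqrt m; have u2 : 2 <= u by rewrite /u; lra.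
have l1 : 1 <= log2 u by rewrite -log2_2 le_log2.
rewrite -[_%:~R]/((2 ^ k)%:R) natrX -powR_mulrn // ler_powR ?ler1n // -/m.
by apply: (@le_trans _ _ (2 * u)); [rewrite /u; lra | rewrite ler_peMr //; lra].
Qed.

Lemma nsf_pow_le s f : (0 < s)%N -> (0 < f)%N -> (5 <= s + f)%N ->
  ((@nsf R s f)%:~R : R) ^ (- f%:Z ^+ 2 + f%:Z - 1) <= (2 ^+ (s + f - 1))^-1.
Proof.
move=> s0 f0 h; have := nsf_ge s0 f0 h; rewrite nsf_exponent addn1.
have := nsf_ge0 s f; case: (nsf s f) => // n _; rewrite lez_nat => hn.
have n1 : (1 <= n)%N by apply: leq_trans hn; rewrite expn_gt0.
rewrite -exprnN lef_pV2 ?posrE ?exprn_gt0 ?ltr0n // -!natrX ler_nat.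
by apply: leq_trans hn _; rewrite expnS leq_pmulr // expn_gt0 n1.
Qed.

(** The case f = 1 is set apart because at s = 3, f = 1 the required bound equals 1/4 = 2^-(s+f-2),
    and the inequality is strict. *)
Definition alpha_mahler s f : R := if f == 1 then 1 else (2 ^+ (s + f - 2))^-1.

Lemma alpha_bound_lt s f : (0 < s)%N -> (0 < f)%N ->
  alpha_bound s f < alpha_mahler s f.
Proof.
move=> s0 f0; rewrite /alpha_bound -/(bound_exponent s f).
have E0 : 0 < 2 `^ bound_exponent s f :> R by rewrite powR_gt0.
set N := _ ^ _; have N1 : N <= 1 by exact: nsf_pow_le1.
have small (c : R) : bound_exponent s f < c -> 2 `^ bound_exponent s f * N < 2 `^ c.
  move=> /ltr_powR2; apply: le_lt_trans; rewrite -[leRHS]mulr1.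
  by rewrite ler_wpM2l // ltW.
have pow2N k : 2 `^ (- k%:R) = (2 ^+ k)^-1 :> R by rewrite powRN powR_mulrn.
rewrite /alpha_mahler; have [f1|f1] := eqVneq f 1%N.
  have := small 0; rewrite powRr0; apply.
  rewrite bound_exponentE // f1 log2_1; lra.
have b1 : 1 <= log2 f%:R :> R by rewrite -[leLHS]log2_2 le_log2 // ler_nat; lia.
have f2 : (2 : R) <= f%:R by rewrite ler_nat; lia.
have [h|h] := leqP 5 (s + f).
  have ab : 2 <= log2 s%:R + log2 f%:R :> R.
    rewrite -log2M ?ltr0n // -natrM (_ : 2 = log2 (2 ^+ 2)); last by rewrite log2X // log2_2 mulr1.
    by rewrite le_log2 // -natrX ler_nat; nia.
  have E1 : 2 `^ bound_exponent s f < 1.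
    rewrite -[ltRHS](powRr0 2); apply: ltr_powR2; rewrite bound_exponentE //.
    have := @mulr_ge0 R (f%:R ^+ 2 - f%:R) (log2 s%:R + log2 f%:R - 2) ltac:(nra) ltac:(lra).
    nra.
  apply: (@le_lt_trans _ _ (2 `^ bound_exponent s f * (2 ^+ (s + f - 1))^-1)).
    by rewrite ler_wpM2l ?(ltW E0) //; exact: nsf_pow_le.
  have -> : (s + f - 1 = (s + f - 2).+1)%N by lia.
  have p0 : 0 < (2 ^+ (s + f - 2))^-1 :> R by rewrite invr_gt0 exprn_gt0.
  rewrite exprS invfM mulrA -[ltRHS]mul1r ltr_pM2r //; lra.
(* For these pairs the power of [nsf] is only bounded by 1; the real exponent alone is small
   enough. *)
have [[es ef]|[[es ef]|[es ef]]] : (s = 1 /\ f = 2 \/ s = 1 /\ f = 3 \/ s = 2 /\ f = 2)%N by lia.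
- rewrite -pow2N; apply: small; rewrite bound_exponentE // es ef log2_1 log2_2 -[(1 + 2 - 2)%N]/1%N; lra.
- rewrite -pow2N; apply: small; rewrite bound_exponentE // es ef log2_1 -[(1 + 3 - 2)%N]/2%N.
  (* That is, 2^3 <= 3^2. *)
  have : 3 <= 2 * log2 3 :> R.
    rewrite -log2X // -[leLHS]mulr1 -[X in _ * X]log2_2 -log2X // le_log2 // -!natrX ler_nat //.
  lra.
- rewrite -pow2N; apply: small; rewrite bound_exponentE // es ef log2_2 -[(2 + 2 - 2)%N]/2%N; lra.
Qed.

End AlphaBound.

(** * From the group to polynomials *)

Section Embedding.
Variables (C : numClosedFieldType) (G : choiceType).
Implicit Types (A : seq G) (u : G -> C) (phi : G -> nat).

Definition embed A u phi : {poly C} := \sum_(a <- A) u a *: 'X^(phi a).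

(** By injectivity each coefficient collects at most one [u a]; the empty ones contribute
    [F 0 = 0]. *)
Lemma sum_coef_embed (V : nmodType) (F : C -> V) A u phi : F 0 = 0 -> uniq A ->
  {in A &, injective phi} -> sum_coef F (embed A u phi) = \sum_(a <- A) F (u a).
Proof.
move=> F0 uA inj; set P := embed A u phi.
pose n := maxn (size P) (\max_(a <- A) (phi a).+1).
have phin a : a \in A -> (phi a < n)%N.
  by move=> aA; rewrite leq_max; apply/orP; right; exact: leq_bigmax_seq.
have coefP i : P`_i = \sum_(a <- A | phi a == i) u a.
  rewrite coef_sum [RHS]big_mkcond; apply: eq_bigr => a _.
  by rewrite coefZ coefXn eq_sym; case: eqP; rewrite ?mulr1 ?mulr0.
rewrite (@sum_coefE _ _ _ _ n) ?leq_maxl //.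
transitivity (\sum_(i < n) \sum_(a <- A | phi a == i) F (u a)).
  apply: eq_bigr => i _; rewrite coefP -big_filter -[RHS]big_filter.
  case E : [seq a <- A | phi a == i] => [|a [|b s]]; first by rewrite !big_nil.
    by rewrite !big_seq1.
  have : uniq [seq a <- A | phi a == i] by rewrite filter_uniq.
  have : a \in [seq a <- A | phi a == i] by rewrite E mem_head.
  have : b \in [seq a <- A | phi a == i] by rewrite E !in_cons eqxx orbT.
  rewrite !mem_filter E => /andP[/eqP bi bA] /andP[/eqP ai aA] /=.
  by rewrite (inj a b) ?ai ?bi // mem_head.
rewrite (exchange_big_dep predT) //= big_seq [RHS]big_seq; apply: eq_bigr => a aA.
by rewrite (big_pred1 (Ordinal (phin a aA))).
Qed.

End Embedding.

(** * Norms and convolutions on the group *)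

Section Transfer.
Variables (R : realType) (G : zmodType).
Implicit Types (x y : G -> R[i]).
Local Notation normc := (@Normc.normc R).

Lemma complex_archimedean : Num.archimedean_axiom R[i].
Proof.
move=> z; exists (Num.trunc (normc z)).+1.
rewrite -(rmorph_nat (real_complex R)) -[`|z|]/((normc z)%:C)%C ltcR.
exact: truncnS_gt.
Qed.

Lemma Sigma_supp k x : Sigma k x ->
  exists A : seq G, [/\ uniq A, (size A <= k)%N & forall g, (g \in A) = (x g != 0)].
Proof.
move=> hx; have fx : finite_set (supp x) by apply/finite_set_leP; exists k.
exists (finmap.enum_fset (fset_set (supp x))); split; first exact: finmap.fset_uniq.
  exact: geq_card_fset_set.
move=> g; rewrite in_fset_set //; apply/idP/idP; first by rewrite inE.
by move=> h; rewrite inE.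
Qed.

Lemma esum_supp (h : G -> R) (A : seq G) : uniq A -> (forall g, 0 <= h g) ->
  (forall g, g \notin A -> h g = 0) ->
  (\esum_(g in [set: G]) (h g)%:E = (\sum_(g <- A) h g)%:E)%E.
Proof.
move=> uA h0 hA; transitivity (\esum_(g in [set` A]) (h g)%:E)%E.
  rewrite [RHS]esum_mkcond; apply: eq_esum => g _; case: ifPn => //.
  by rewrite mem_setE => /hA ->.
rewrite esum_fset; [|exact: finite_seq|by move=> g _; rewrite lee_fin].
by rewrite -fsbig_seq // sumEFin.
Qed.

Lemma normc_ge0 (z : R[i]) : 0 <= normc z.
Proof. by case: z => a b; exact: sqrtr_ge0. Qed.

Lemma lpnorm2E x (A : seq G) : uniq A -> (forall g, g \notin A -> x g = 0) ->
  lpnorm 2 x = (Num.sqrt (\sum_(a <- A) normc (x a) ^+ 2))%:E.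
Proof.
move=> uA xA; rewrite /lpnorm (esum_supp uA) => [|g|g /xA ->]; last 2 first.
- exact: powR_ge0.
- by rewrite Normc.normc0 powR0.
rewrite poweR_EFin powR12_sqrt ?sumr_ge0 // => [|g _]; last exact: powR_ge0.
congr (Num.sqrt _)%:E; apply: eq_bigr => a _.
by rewrite -powR_mulrn ?normc_ge0.
Qed.

Lemma lpnorm1E x (A : seq G) : uniq A -> (forall g, g \notin A -> x g = 0) ->
  lpnorm 1 x = (\sum_(a <- A) normc (x a))%:E.
Proof.
move=> uA xA; rewrite /lpnorm (esum_supp uA) => [|g|g /xA ->]; last 2 first.
- exact: powR_ge0.
- by rewrite Normc.normc0 powRr1.
rewrite poweR_EFin invr1 powRr1 ?sumr_ge0 // => [|g _]; last exact: powR_ge0.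
by congr _%:E; apply: eq_bigr => a _; rewrite powRr1 ?normc_ge0.
Qed.

Lemma convolutionE x y (A : seq G) g : uniq A -> (forall h, h \notin A -> x h = 0) ->
  convolution x y g = \sum_(a <- A) x a * y (g - a).
Proof.
move=> uA xA; rewrite fsbig_seq //; symmetry; apply: fsbig_widen => // h [_ /= hA].
by rewrite xA ?mul0r //; apply/negP.
Qed.

(* A Freiman isomorphism onto a set of integers turns the convolution into a product of
   polynomials. *)
Lemma convolution_embed x y (A B : seq G) : torsion_free G ->
  uniq A -> uniq B -> (forall h, h \notin A -> x h = 0) -> (forall h, h \notin B -> y h = 0) ->
  exists phi : G -> nat, exists psi : G -> nat, exists D : seq G,
  [/\ {in A &, injective phi}, {in B &, injective phi}, {in D &, injective psi},
      uniq D /\ (forall g, g \notin D -> convolution x y g = 0)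
    & embed A x phi * embed B y phi = embed D (convolution x y) psi].
Proof.
move=> tf uA uB xA yB; have [phi hphi] := freiman_embedding tf (A ++ B).
have AT a : a \in A -> a \in A ++ B by rewrite mem_cat => ->.
have BT b : b \in B -> b \in A ++ B by rewrite mem_cat => ->; rewrite orbT.
(* Injectivity is the Freiman property for a + b = b + b. *)
have inj : {in A ++ B &, injective phi}.
  move=> a b aT bT e; apply: (addIr b); apply/eqP.
  by rewrite -hphi // e.
pose L := [seq (a, b) | a <- A, b <- B].
pose D := undup [seq p.1 + p.2 | p <- L].
(* The first pair of [L] with sum [g] is used; by the Freiman property any other pair gives the same
   value. *)
pose psi g := let p := nth (0, 0) L (find (fun p => p.1 + p.2 == g) L) in (phi p.1 + phi p.2)%N.
have inD a b : a \in A -> b \in B -> a + b \in D.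
  by move=> aA bB; rewrite mem_undup; apply/mapP; exists (a, b) => //; exact: allpairs_f.
have Dpair g : g \in D -> exists a b, [/\ a \in A, b \in B & g = a + b].
  rewrite mem_undup => /mapP[p /allpairsP[[a b] [/= aA bB ->]] ->].
  by exists a, b.
have psiE a b : a \in A -> b \in B -> psi (a + b) = (phi a + phi b)%N.
  move=> aA bB; have hs : has (fun p => p.1 + p.2 == a + b) L.
    by apply/hasP; exists (a, b) => //; exact: allpairs_f.
  have := nth_find (0, 0) hs; have := mem_nth (0, 0) (etrans (esym (has_find _ _)) hs).
  rewrite /psi; case: (nth _ _ _) => c d /allpairsP[[c' d'] [/= cA dB [-> ->]]] /= /eqP e.
  by apply/eqP; rewrite hphi ?e //; [exact: AT|exact: BT|exact: AT|exact: BT].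
exists phi, psi, D; split.
- by move=> a b aA bA; apply: inj; exact: AT.
- by move=> a b aA bA; apply: inj; exact: BT.
- move=> _ _ /Dpair[a [b [aA bB ->]]] /Dpair[c [d [cA dB ->]]].
  rewrite !psiE // => /eqP.
  by rewrite hphi => [/eqP||||]; [by []|exact: AT|exact: BT|exact: AT|exact: BT].
- split; first exact: undup_uniq.
  move=> g gD; rewrite (convolutionE _ _ uA xA) big_seq big1 // => a aA.
  have [gB|/yB ->] := boolP (g - a \in B); last by rewrite mulr0.
  by move: gD; rewrite -(subrK a g) addrC inD.
rewrite /embed mulr_suml.
transitivity (\sum_(g <- D) \sum_(a <- A) (x a * y (g - a)) *: 'X^(psi g) : {poly R[i]}); last first.
  by apply: eq_bigr => g _; rewrite (convolutionE _ _ uA xA) scaler_suml.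
rewrite exchange_big /= big_seq [RHS]big_seq; apply: eq_bigr => a aA.
(* At most one [b] contributes; as a sum over [B], the expression can be exchanged with the sum over
   [D]. *)
have yE g : y (g - a) = \sum_(b <- B | a + b == g) y b.
  rewrite (eq_bigl (fun b => b == g - a)); last by move=> b; rewrite eq_sym [RHS]eq_sym subr_eq addrC.
  have [gB|gB] := boolP (g - a \in B).
    by rewrite -big_filter filter_pred1_uniq // big_seq1.
  by rewrite yB // big_seq_cond big1 // => b /andP[bB /eqP e]; move: gB; rewrite -e bB.
under [RHS]eq_bigr do rewrite yE mulr_sumr scaler_suml.
rewrite mulr_sumr (exchange_big_dep predT) //= big_seq [RHS]big_seq; apply: eq_bigr => b bB.
under eq_bigl do rewrite eq_sym.
rewrite -big_filter filter_pred1_uniq ?undup_uniq ?inD // big_seq1 psiE //.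
by rewrite -scalerAl -scalerAr scalerA exprD.
Qed.

Lemma sum_normcX (A : seq G) x k :
  \sum_(a <- A) `|x a| ^+ k = ((\sum_(a <- A) normc (x a) ^+ k)%:C)%C.
Proof. by rewrite rmorph_sum; apply: eq_bigr => a _; rewrite rmorphXn. Qed.

Lemma convolution_lower_bound s f x y : (0 < s)%N -> (0 < f)%N -> torsion_free G ->
  Sigma s x -> Sigma f y ->
  ((alpha_mahler R s f)%:E * lpnorm 2 x * lpnorm 1 y <= lpnorm 2 (convolution x y))%E.
Proof.
move=> s0 f0 tf /Sigma_supp[A [uA sA Ax]] /Sigma_supp[B [uB sB By]].
have xA h : h \notin A -> x h = 0 by rewrite Ax negbK => /eqP.
have yB h : h \notin B -> y h = 0 by rewrite By negbK => /eqP.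
have [phi [psi [D [iA iB iD [uD cD] e]]]] := convolution_embed tf uA uB xA yB.
set X := embed A x phi in e; set Y := embed B y phi in e.
have nX : (nterms X <= s)%N.
  rewrite /nterms sum_coef_embed ?eqxx //; apply: leq_trans sA.
  by rewrite -sum1_size leq_sum // => a _; case: (_ != _).
have nY : (nterms Y <= f)%N.
  rewrite /nterms sum_coef_embed ?eqxx //; apply: leq_trans sB.
  by rewrite -sum1_size leq_sum // => a _; case: (_ != _).
have l2E E (u : G -> R[i]) p : uniq E -> {in E &, injective p} ->
    l2sq (embed E u p) = ((\sum_(a <- E) normc (u a) ^+ 2)%:C)%C.
  by move=> uE pE; rewrite /l2sq sum_coef_embed ?normr0 ?expr0n // sum_normcX.
have l1E : l1norm Y = ((\sum_(b <- B) normc (y b))%:C)%C.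
  rewrite /l1norm sum_coef_embed ?normr0 //.
  by rewrite (sum_normcX B y 1).
rewrite (lpnorm2E uA xA) (lpnorm1E uB yB) (lpnorm2E uD cD) -!EFinM lee_fin.
set SX := \sum_(a <- A) _; set SY := \sum_(b <- B) _; set SZ := \sum_(a <- D) _.
have SX0 : 0 <= SX by rewrite sumr_ge0 // => a _; rewrite exprn_ge0 ?normc_ge0.
have SZ0 : 0 <= SZ by rewrite sumr_ge0 // => a _; rewrite exprn_ge0 ?normc_ge0.
have SY0 : 0 <= SY by rewrite sumr_ge0 // => a _; rewrite normc_ge0.
have a0 : 0 < alpha_mahler R s f.
  by rewrite /alpha_mahler; case: ifP => _; rewrite ?ltr01 // invr_gt0 exprn_gt0.
(* Squaring reduces the claim to finite real sums, which embed into [R[i]] as [l2sq] and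
   [l1norm]. *)
rewrite -(@ler_pXn2r _ 2) ?nnegrE ?mulr_ge0 ?sqrtr_ge0 ?(ltW a0) // !exprMn !sqr_sqrtr // -mulrA.
suff : SX * SY ^+ 2 <= (alpha_mahler R s f ^+ 2)^-1 * SZ.
  by rewrite ler_pdivlMl // exprn_gt0.
have eX : l2sq X = (SX%:C)%C by rewrite l2E.
have eZ : l2sq (X * Y) = (SZ%:C)%C by rewrite e l2E.
rewrite /alpha_mahler; have [f1|f1] := eqVneq f 1%N.
  rewrite f1 in nY; rewrite expr1n invr1 mul1r -lecR rmorphM rmorphXn /= -eX -eZ -l1E.
  by rewrite l2sq_mul_monomial.
have := @l2sq_mul_ge _ complex_archimedean X Y s.-1 f.-1.
rewrite !prednK // => /(_ nX nY); rewrite eX eZ l1E.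
have -> : (s.-1 + f.-1 = s + f - 2)%N by lia.
rewrite exprVn invrK -lecR !rmorphM !rmorphXn rmorph_nat; exact.
Qed.

End Transfer.

Theorem mainTheorem4 (R : realType) :
  exists alpha : nat -> nat -> R,
    forall s f : nat, (0 < s)%N -> (0 < f)%N ->
      alpha_bound s f < alpha s f
      /\ forall G : zmodType, torsion_free G ->
         forall x y : G -> R[i], Sigma s x -> Sigma f y ->
           ((alpha s f)%:E * lpnorm 2 x * lpnorm 1 y
              <= lpnorm 2 (convolution x y))%E.
Proof.
exists (alpha_mahler R) => s f s0 f0; split; first exact: alpha_bound_lt.
by move=> G tf x y xs yf; exact: convolution_lower_bound.
Qed.
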